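(* Let $\Delta$ and $\Lambda$ be countable distance value sets. Then $\mathrm{Aut}(\mathbb{U}^<_\Delta)$ and $\mathrm{Aut}(\mathbb{U}^<_\Lambda)$ are isomorphic as topological groups if and only if $\Delta$ and $\Lambda$ are equivalent.
   Context: A distance value set is a set $\Delta$ of positive real numbers such that for all $x,y\in\Delta$, $\min\{x+y,\sup\Delta\}\in\Delta$. A $\Delta$-metric space is a metric space whose nonzero distances all lie in $\Delta$. For countable $\Delta$, the class of finite linearly ordered $\Delta$-metric spaces (structures with binary relations $R_s$, $s\in\Delta$, encoding distance $s$, and a linear order $<$) is a Fraïssé class; $\mathbb{U}^<_\Delta$ denotes its Fraïssé limit, and $\mathrm{Aut}(\mathbb{U}^<_\Delta)$ its group of order-preserving surjective isometries with the topology of pointwise convergence (the underlying set carrying the discrete topology). A triple $(x,y,z)$ of positive reals is a $\Delta$-triangle if $x,y,z\in\Delta$ and $|x-y|\le z\le x+y$; $\Delta$ and $\Lambda$ are equivalent if there is a bijection $f:\Delta\to\Lambda$ such that $(x,y,z)$ is a $\Delta$-triangle iff $(f(x),f(y),f(z))$ is a $\Lambda$-triangle. *)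

(* Defs.v *)
From HB Require Import structures.
From mathcomp Require Import all_boot all_order all_algebra.
From mathcomp Require Import all_classical all_reals all_analysis.

Set Implicit Arguments.
Unset Strict Implicit.
Unset Printing Implicit Defensive.

Import Order.TTheory GRing.Theory Num.Theory.
Local Open Scope classical_set_scope.
Local Open Scope ring_scope.

(* The supremum is taken in the extended reals: the real-valued [sup] is 0 on
   unbounded sets, whereas here min{x + y, sup D} is x + y when D is unbounded. *)
Definition distance_value_set (R : realType) (D : set R) : Prop :=
  (forall x, D x -> 0 < x) /\
  (forall x y, D x -> D y ->
     (EFin @` D) (mine (x + y)%:E (ereal_sup (EFin @` D)))).

Definition triangle (R : realType) (D : set R) (x y z : R) : Prop :=
  [/\ D x, D y & D z] /\ `|x - y| <= z <= x + y.

Definition equivalent (R : realType) (D E : set R) : Prop :=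
  exists2 f : R -> R, set_bij D E f &
    forall x y z, D x -> D y -> D z ->
      (triangle D x y z <-> triangle E (f x) (f y) (f z)).

Record structure (L : Type) := Structure {
  carrier :> Type;
  interp : L -> carrier -> carrier -> Prop }.

Definition embedding (L : Type) (A B : structure L) (f : A -> B) : Prop :=
  injective f /\ forall l x y, interp l x y <-> interp l (f x) (f y).

Definition isomorphism (L : Type) (A B : structure L) (f : A -> B) : Prop :=
  bijective f /\ forall l x y, interp l x y <-> interp l (f x) (f y).

Definition substructure (L : Type) (A : structure L) (S : set A) :
    structure L :=
  @Structure L (set_type S) (fun l x y => interp l (val x) (val y)).

Definition ultrahomogeneous (L : Type) (U : structure L) : Prop :=
  forall (S T : set U) (f : substructure S -> substructure T),
    finite_set S -> finite_set T -> isomorphism f ->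
    exists2 g : U -> U, isomorphism g & forall x : S, g (val x) = val (f x).

Definition age (L : Type) (U A : structure L) : Prop :=
  finite_set [set: A] /\ exists f : A -> U, embedding f.

(* At most countable: for the empty distance value set the limit is a point. *)
Definition fraisse_limit (L : Type) (K : structure L -> Prop)
    (U : structure L) : Prop :=
  [/\ countable [set: U], ultrahomogeneous U & forall A, age U A <-> K A].

Definition metric (R : realType) (T : Type) (d : T -> T -> R) : Prop :=
  [/\ forall x y, 0 <= d x y,
      forall x y, d x y = 0 <-> x = y,
      forall x y, d x y = d y x &
      forall x y z, d x z <= d x y + d y z].

Definition strict_linear_order (T : Type) (lt : T -> T -> Prop) : Prop :=
  [/\ forall x, ~ lt x x,
      forall x y z, lt x y -> lt y z -> lt x z &
      forall x y, x <> y -> lt x y \/ lt y x].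

(* One symbol R_s for each s in D, and one symbol for the strict order. *)
Inductive lang (R : realType) (D : set R) : Type :=
| Dist of set_type D
| Lt.

Definition ordered_metric_space (R : realType) (D : set R)
    (A : structure (lang D)) : Prop :=
  (exists d : A -> A -> R,
     [/\ metric d,
         forall x y, x <> y -> D (d x y) &
         forall (s : D) x y, interp (Dist s) x y <-> d x y = val s]) /\
  strict_linear_order (@interp _ A (Lt D)).

Definition finite_ordered_metric_space (R : realType) (D : set R)
    (A : structure (lang D)) : Prop :=
  finite_set [set: A] /\ ordered_metric_space A.

HB.mixin Record Group_Topological_isTopologicalGroup G
    of Group G & Topological G := {
  mulg_continuous : continuous (fun x : G * G => (x.1 * x.2)%g);
  invg_continuous : continuous (fun x : G => (x^-1)%g) }.

#[short(type="topologicalGroupType")]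
HB.structure Definition TopologicalGroup :=
  { G of Group_Topological_isTopologicalGroup G & Group G & Topological G }.

Definition topological_group_isomorphic (G H : topologicalGroupType) : Prop :=
  exists (f : G -> H) (g : H -> G),
    [/\ cancel f g, cancel g f, {morph f : x y / (x * y)%g},
        continuous f & continuous g].

Record aut (L : Type) (A : structure L) := Aut {
  aut_fun :> A -> A;
  aut_isomorphism : isomorphism aut_fun }.

Section AutGroup.
Variables (L : Type) (A : structure L).
Implicit Types f g h : aut A.

Lemma autP f g : (forall x, f x = g x) -> f = g.
Proof.
case: f g => [f fP] [g gP] /= /funext fg; subst g; congr Aut.
exact: Prop_irrelevance.
Qed.

Lemma aut_one_subproof : isomorphism (@id A).
Proof. by split=> //; exists id. Qed.
Definition aut_one := Aut aut_one_subproof.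

Lemma aut_mul_subproof f g : isomorphism (f \o g).
Proof.
case: f g => [f [bf rf]] [g [bg rg]] /=; split; first exact: bij_comp.
by move=> l x y; rewrite rg rf.
Qed.
Definition aut_mul f g := Aut (aut_mul_subproof f g).

Lemma aut_inv_ex f : exists g : A -> A, cancel f g /\ cancel g f.
Proof. by case: f => [f [[g fg gf] rf]]; exists g. Qed.

Definition aut_inv_fun f : A -> A := projT1 (cid (aut_inv_ex f)).

Lemma aut_funK f : cancel f (aut_inv_fun f).
Proof. by rewrite /aut_inv_fun; case: cid => g []. Qed.

Lemma aut_inv_funK f : cancel (aut_inv_fun f) f.
Proof. by rewrite /aut_inv_fun; case: cid => g []. Qed.

Lemma aut_inv_subproof f : isomorphism (aut_inv_fun f).
Proof.
split; first by exists f; [exact: aut_inv_funK|exact: aut_funK].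
move=> l x y; have := (aut_isomorphism f).2 l (aut_inv_fun f x) (aut_inv_fun f y).
by rewrite !aut_inv_funK; exact: iff_sym.
Qed.
Definition aut_inv f := Aut (aut_inv_subproof f).

HB.instance Definition _ := gen_eqMixin (aut A).
HB.instance Definition _ := gen_choiceMixin (aut A).

Lemma aut_mulA : associative aut_mul. Proof. by move=> f g h; apply: autP. Qed.
Lemma aut_mul1 : left_id aut_one aut_mul. Proof. by move=> f; apply: autP. Qed.
Lemma aut_mulr1 : right_id aut_one aut_mul.
Proof. by move=> f; apply: autP. Qed.
Lemma aut_mulV : left_inverse aut_one aut_inv aut_mul.
Proof. by move=> f; apply: autP => x; exact: aut_funK. Qed.
Lemma aut_mulrV : right_inverse aut_one aut_inv aut_mul.
Proof. by move=> f; apply: autP => x; exact: aut_inv_funK. Qed.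

HB.instance Definition _ := isGroup.Build (aut A)
  aut_mulA aut_mul1 aut_mulr1 aut_mulV aut_mulrV.

Definition aut_ptws f : {ptws A -> discrete_topology {classic A}} := aut_fun f.

HB.instance Definition _ :=
  Topological.copy (aut A) (initial_topology aut_ptws).

Lemma aut_cvgP (F : set_system (aut A)) f : Filter F ->
  F --> f <-> forall x, F [set g : aut A | g x = f x].
Proof.
move=> FF; split=> [Ff x|Ff].
  apply: Ff; pose e (g : {ptws A -> discrete_topology {classic A}}) := g x.
  have : nbhs (aut_ptws f) (e @^-1` [set e (aut_ptws f)]).
    have /cvg_sup/(_ x) : nbhs (aut_ptws f) --> aut_ptws f by [].
    apply; exists (e @^-1` [set e (aut_ptws f)]); split => //.
    by exists [set e (aut_ptws f)] => //; exact: discrete_open.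
  exact: (@initial_continuous (aut A) _ aut_ptws f).
move=> W [_ [[B Bo <-] Bf BW]]; apply: filterS BW _.
suff : aut_ptws @ F --> aut_ptws f by apply; exact: open_nbhs_nbhs.
apply/cvg_sup => x V [_ [[C Co <-] Cf CV]].
apply: (@filterS _ F _ [set g : aut A | g x = f x]) (Ff x) => g /= gx.
by apply: CV; rewrite /= /aut_ptws gx.
Qed.

Lemma aut_nbhs f x : nbhs f [set g : aut A | g x = f x].
Proof. by move: x; apply/aut_cvgP. Qed.

Lemma aut_mul_continuous : continuous (fun x : aut A * aut A => (x.1 * x.2)%g).
Proof.
move=> [f g]; apply/aut_cvgP => x.
exists ([set h : aut A | h (g x) = f (g x)], [set h : aut A | h x = g x]).
  by split; exact: aut_nbhs.
by case=> h k [/= hE kE]; rewrite kE hE.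
Qed.

Lemma aut_inv_continuous : continuous (fun x : aut A => (x^-1)%g).
Proof.
move=> f; apply/aut_cvgP; first exact/fmap_filter/nbhs_filter.
move=> x; apply: filterS (aut_nbhs f (aut_inv_fun f x)).
by move=> g /= gE; rewrite -{1}(aut_inv_funK f x) -gE aut_funK.
Qed.

HB.instance Definition _ := Group_Topological_isTopologicalGroup.Build (aut A)
  aut_mul_continuous aut_inv_continuous.

End AutGroup.

(* Main.v *)
(** A bijection [Delta -> Lambda] preserving triangles turns every ordered
[Lambda]-metric space into an ordered [Delta]-metric space. Relabelled in this
way, [V] becomes a Fraisse limit of the same class as [U], hence is isomorphic
to [U], and [aut V] does not depend on the labels.

Conversely, every proper open subgroup [H] of [aut U] fixes a point. Indeed, let
[H] contain the pointwise stabilizer of a finite set [S], let [b] be the least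
element of [S] and [S' := S `\ b]. If some [h] in [H] moves [b], then up to
inverting [h] we have [b < h b], so [b] does not belong to [h S], and [H]
contains the stabilizer of the finite set [S' `|` h S], which does not contain
[b] either. Hence [H] contains all automorphisms fixing [S'] and moving [b] by a
small distance, and repeatedly doubling this distance shows that [H] contains
the stabilizer of the smaller set [S'].

A topological isomorphism therefore matches point stabilizers with point
stabilizers, which gives an equivariant bijection [U -> V]. The orbits of
unordered pairs are the distances, so this bijection induces a bijection
[Delta -> Lambda], and it preserves triangles because these are the triples of
distances realized by three points. *)

Require Import Defs.
From mathcomp Require Import all_boot all_order all_algebra.
From mathcomp Require Import all_classical all_reals all_analysis.
From mathcomp Require Import finmap lra.

Set Implicit Arguments.
Unset Strict Implicit.
Unset Printing Implicit Defensive.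

Import Order.TTheory GRing.Theory Num.Theory.
Local Open Scope classical_set_scope.
Local Open Scope ring_scope.

Lemma finite_set_descent (T : Type) (P : set T -> Prop) :
    (forall S, finite_set S -> S !=set0 -> P S ->
       exists2 x, S x & P (S `\ x)) ->
  forall S, finite_set S -> P S -> P set0.
Proof.
move=> Pdec S; elim/Pchoice: T => T in P Pdec S *.
have [n] := ubnP #|` fset_set S|.
elim: n S => // n IHn S; rewrite ltnS => Sn Sfin PS.
have [<-//|/set0P S0] := eqVneq S set0.
have [x Sx PSx] := Pdec S Sfin S0 PS.
apply: IHn PSx; last exact: finite_setD.
apply: leq_trans Sn; rewrite fset_setD1//.
by rewrite [ltnRHS](cardfsD1 x) in_fset_set// mem_set.
Qed.

Lemma finite_set_least (T : Type) (lt : T -> T -> Prop) (S : set T) :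
    strict_linear_order lt -> finite_set S -> S !=set0 ->
  exists2 x, S x & forall y, S y -> ~ lt y x.
Proof.
elim/Pchoice: T => T in lt S * => -[ltxx lt_trans _] /finite_seqP[s ->] {S}.
elim: s => [|a s IHs] => [[]//|_].
have [[x xs]|s0] := pselect ([set` s] !=set0); last first.
  exists a => [|y]; first exact: mem_head.
  rewrite /= inE => /predU1P[->|ys]; first exact: ltxx.
  by case: s0; exists y.
have [{xs}x xs xmin] := IHs (ex_intro _ x xs).
have [ax|nax] := pselect (lt a x).
  exists a => [|y]; first exact: mem_head.
  rewrite /= inE => /predU1P[->|ys ya]; first exact: ltxx.
  exact: xmin ys (lt_trans _ _ _ ya ax).
exists x => [|y]; first by rewrite /= inE; apply/orP; right.
by rewrite /= inE => /predU1P[->//|/xmin].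
Qed.

Lemma countable_sum (A B : Type) : countable [set: A] -> countable [set: B] ->
  countable [set: A + B].
Proof.
move=> /countable_injP[i iinj] /countable_injP[j jinj]; apply/countable_injP.
exists (fun x : A + B => choice.pickle
  (match x with inl a => inl (i a) | inr b => inr (j b) end : nat + nat)).
move=> [a|b] [a'|b'] _ _ /(pcan_inj choice.pickleK)[] //.
  by move/iinj => ->//; rewrite in_setT.
by move/jinj => ->//; rewrite in_setT.
Qed.

Lemma rasiowa_sikorski_chain (I P : Type) (le : P -> P -> Prop)
    (E : I -> set P) (x0 : P) :
    countable [set: I] -> (forall x, le x x) ->
    (forall y x z, le x y -> le y z -> le x z) ->
    (forall i x, exists2 y, le x y & E i y) ->
  exists s : nat -> P, (forall m n, (m <= n)%N -> le (s m) (s n)) /\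
                       (forall i, exists n, E i (s n)).
Proof.
move=> /countable_injP[c cinj] le_refl le_trans dense.
have /choice[F FP] (nx : nat * P) : exists y, le nx.2 y /\
    forall i, c i = nx.1 -> E i y.
  case: nx => n x /=; have [[i <-]|nc] := pselect (exists i, c i = n).
    have [y xy iy] := dense i x; exists y; split=> // j.
    by move/cinj => -> //; rewrite in_setT.
  by exists x; split=> // i ci; case: nc; exists i.
pose fix s n := if n is m.+1 then F (m, s m) else x0.
exists s; split=> [|i]; last by exists (c i).+1; exact: (FP (c i, s (c i))).2.
by apply: homo_leq => // n; exact: (FP (n, s n)).1.
Qed.

(** * Homogeneous structures and uniqueness of Fraisse limits *)

Section HomogeneousStructure.
Variables (L : Type).
Implicit Types U V A B : structure L.

Lemma substructure_embedding U (S : set U) :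
  embedding (val : substructure S -> U).
Proof. by split=> //; exact: val_inj. Qed.

Lemma finite_substructure U (S : set U) :
  finite_set S -> finite_set [set: substructure S].
Proof. by rewrite (eq_finite_set (card_setT S)). Qed.

Lemma embedding_comp A B U (f : B -> U) (g : A -> B) :
  embedding f -> embedding g -> embedding (f \o g).
Proof.
move=> [finj fP] [ginj gP]; split; first exact: inj_comp.
by move=> l x y; rewrite gP fP.
Qed.

Lemma aut_embedding U (g : aut U) : embedding g.
Proof. by have [/bij_inj ginj gP] := aut_isomorphism g. Qed.

Lemma ultrahomogeneous_embeddings U B (h k : B -> U) : ultrahomogeneous U ->
    finite_set [set: B] -> embedding h -> embedding k ->
  exists g : aut U, forall b, g (h b) = k b.
Proof.
move=> hom Bfin [hinj hP] [kinj kP].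
have rangeE (f : B -> U) (x : substructure (range f)) : exists b, f b = val x.
  by have [b _ <-] := set_valP x; exists b.
have /choice[h' h'K] := rangeE h; have /choice[k' k'K] := rangeE k.
have in_range (f : B -> U) b : f b \in range f by apply/mem_set; exists b.
pose iso x : substructure (range k) := SigSub (in_range k (h' x)).
have [|g gP gE] := hom _ _ iso (finite_image h Bfin) (finite_image k Bfin).
  split=> [|l x y]; last by rewrite /= -kP hP !h'K.
  exists (fun y => SigSub (in_range h (k' y))) => x; apply: val_inj => /=.
    by rewrite -h'K; congr h; apply: kinj; rewrite k'K.
  by rewrite -k'K; congr k; apply: hinj; rewrite h'K.
exists (Aut gP) => b; rewrite /= [LHS](gE (SigSub (in_range h b))) /=.
by congr k; apply: hinj; rewrite h'K.
Qed.

Lemma fraisse_limit_extension (K : structure L -> Prop) U A B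
    (i : B -> A) (h : B -> U) :
    fraisse_limit K U -> finite_set [set: B] -> K A ->
    embedding i -> embedding h ->
  exists2 e : A -> U, embedding e & forall b, e (i b) = h b.
Proof.
move=> [_ hom ageU] Bfin /ageU[_ [e eP]] iP hP.
have [g gE] := ultrahomogeneous_embeddings hom Bfin (embedding_comp eP iP) hP.
by exists (g \o e) => //; exact: embedding_comp (aut_embedding g) eP.
Qed.

Definition partial_isomorphism U V (m : set (U * V)) : Prop :=
  forall p q, m p -> m q ->
    (p.1 = q.1 <-> p.2 = q.2) /\
    forall l, interp l p.1 q.1 <-> interp l p.2 q.2.

Lemma partial_isomorphism_sym U V (m : set (U * V)) :
  partial_isomorphism m -> partial_isomorphism [set p : V * U | m (p.2, p.1)].
Proof.
move=> mP p q mp mq; have [eq rel] := mP _ _ mp mq.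
by split=> [|l]; exact: iff_sym.
Qed.

Lemma partial_isomorphism_forth (K : structure L -> Prop) U V
    (m : set (U * V)) (u : U) :
    fraisse_limit K U -> fraisse_limit K V -> finite_set m ->
    partial_isomorphism m ->
  exists v, partial_isomorphism ((u, v) |` m).
Proof.
move=> [_ _ ageU] hV mfin mP; pose A := substructure (u |` fst @` m).
have KA : K A.
  apply/ageU; split; last by exists val; exact: substructure_embedding.
  apply: finite_substructure; rewrite finite_setU; split=> //.
  exact: finite_image.
have inA p : m p -> p.1 \in u |` fst @` m.
  by move=> mp; apply/mem_set; right; exists p.
pose B := @Structure L (set_type m) (fun l p q => interp l (val p).1 (val q).1).
pose i (p : B) : A := SigSub (inA _ (set_valP p)).
have mB (p q : B) := mP _ _ (set_valP p) (set_valP q).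
have eqB (p q : B) : (val p).1 = (val q).1 -> (val p).2 = (val q).2 -> p = q.
  move=> pq1 pq2; apply: val_inj.
  by rewrite [LHS]surjective_pairing pq1 pq2 -surjective_pairing.
have [|||e [einj eP] eE] :=
    @fraisse_limit_extension K V A B i (fun p => (val p).2) hV _ KA.
- by rewrite /= (eq_finite_set (card_setT m)).
- split=> // p q /(congr1 val) /= pq; apply: eqB => //.
  exact: (mB p q).1.1.
- split=> [p q pq|l p q]; last exact: (mB p q).2.
  by apply: eqB => //; exact: (mB p q).1.2.
have uA : u \in u |` fst @` m by apply/mem_set; left.
exists (e (SigSub uA)) => p q mp mq.
have lift r : ((u, e (SigSub uA)) |` m) r -> exists x : A, r = (val x, e x).
  move=> [->|mr]; first by exists (SigSub uA).
  exists (SigSub (inA _ mr)).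
  have -> : SigSub (inA _ mr) = i (SigSub (mem_set mr)) by exact: val_inj.
  by rewrite eE -surjective_pairing.
have [x ->] := lift _ mp; have [y ->] := lift _ mq => /=.
by split=> [|l]; [split=> [/val_inj->|/einj->]|exact: eP].
Qed.

Lemma partial_isomorphism_back (K : structure L -> Prop) U V
    (m : set (U * V)) (v : V) :
    fraisse_limit K U -> fraisse_limit K V -> finite_set m ->
    partial_isomorphism m ->
  exists u, partial_isomorphism ((u, v) |` m).
Proof.
move=> hU hV mfin /partial_isomorphism_sym mP.
have [|u uP] := partial_isomorphism_forth v hV hU _ mP.
  by apply: finite_preimage mfin => -[? ?] [? ?] _ _ [-> ->].
exists u => p q mp mq; apply: (partial_isomorphism_sym uP).
  by case: mp => [->|]; [left|right; rewrite /= -surjective_pairing].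
by case: mq => [->|]; [left|right; rewrite /= -surjective_pairing].
Qed.

Lemma partial_isomorphism_graph U V (m : set (U * V)) :
    partial_isomorphism m -> (forall u, exists v, m (u, v)) ->
    (forall v, exists u, m (u, v)) ->
  exists f : U -> V, isomorphism f.
Proof.
move=> mP /choice[f fP] /choice[g gP]; exists f.
split=> [|l x y]; last exact: (mP _ _ (fP x) (fP y)).2.
exists g => [u|v]; first exact/(mP _ _ (gP (f u)) (fP u)).1.
exact/(mP _ _ (fP (g v)) (gP v)).1.
Qed.

Lemma fraisse_limit_unique (K : structure L -> Prop) U V :
    fraisse_limit K U -> fraisse_limit K V ->
  exists f : U -> V, isomorphism f.
Proof.
move=> hU hV; have [countU _ _] := hU; have [countV _ _] := hV.
pose finite_partial (m : set (U * V)) := finite_set m /\ partial_isomorphism m.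
pose P := {m | finite_partial m}.
pose E (x : U + V) (m : P) := match x with
  | inl u => exists v, sval m (u, v) | inr v => exists u, sval m (u, v) end.
have empty : finite_partial set0 by [].
have dense x (m : P) : exists2 n : P, sval m `<=` sval n & E x n.
  case: m => m [mfin mP].
  have grow u v : partial_isomorphism ((u, v) |` m) ->
      exists2 n : P, m `<=` sval n & sval n (u, v).
    move=> uvP; have uv : finite_partial ((u, v) |` m).
      by split=> //; rewrite finite_setU.
    by exists (exist _ _ uv); [right|left].
  case: x => [u|v].
    have [v /grow[n mn nuv]] := partial_isomorphism_forth u hU hV mfin mP.
    by exists n => //; exists v.
  have [u /grow[n mn nuv]] := partial_isomorphism_back v hU hV mfin mP.
  by exists n => //; exists u.
have [m|m1 m2 m3|s [s_mono sE]] :=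
    rasiowa_sikorski_chain (exist _ _ empty) (countable_sum countU countV)
      _ _ dense.
- exact: subset_refl.
- exact: subset_trans.
apply: (@partial_isomorphism_graph _ _ (\bigcup_n sval (s n))).
- move=> p q [m _ mp] [n _ nq]; apply: (proj2 (svalP (s (maxn m n)))).
    exact: s_mono (leq_maxl m n) _ mp.
  exact: s_mono (leq_maxr m n) _ nq.
- by move=> u; have [n [v nuv]] := sE (inl u); exists v, n.
- by move=> v; have [n [u nuv]] := sE (inr v); exists u, n.
Qed.

End HomogeneousStructure.

(** * Stabilizers and reducts *)

Definition subgroup (G : groupType) (H : set G) : Prop :=
  [/\ H 1%g, forall x y, H x -> H y -> H (x * y)%g &
      forall x, H x -> H (x^-1)%g].

Section Stabilizer.
Variables (L : Type) (U : structure L).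
Implicit Types (g h : aut U) (S T : set U).

Lemma aut_mulE g h x : (g * h)%g x = g (h x). Proof. by []. Qed.

Lemma autK g : cancel g (g^-1)%g. Proof. exact: aut_funK. Qed.

Lemma autVK g : cancel (g^-1)%g g. Proof. exact: aut_inv_funK. Qed.

Definition stabilizer S : set (aut U) := [set g | forall x, S x -> g x = x].

Lemma subgroup_stabilizer S : subgroup (stabilizer S).
Proof.
split=> [//|g h gS hS x Sx|g gS x Sx]; first by rewrite aut_mulE hS// gS.
by rewrite -{1}(gS x Sx) autK.
Qed.

Lemma stabilizerS S T : S `<=` T -> stabilizer T `<=` stabilizer S.
Proof. by move=> ST g gT x /ST/gT. Qed.

Lemma stabilizer_setU1 S b g :
  stabilizer (b |` S) g <-> g b = b /\ stabilizer S g.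
Proof.
split=> [gbS|[gb gS] x [->//|/gS//]].
by split; [apply: gbS; left|move=> x Sx; apply: gbS; right].
Qed.

Lemma stabilizer_image S g h :
  stabilizer (h @` S) g -> stabilizer S (h^-1 * g * h)%g.
Proof. by move=> gS x Sx; rewrite !aut_mulE gS ?autK//; exists x. Qed.

Lemma nbhs1_stabilizer (W : set (aut U)) : nbhs (1%g : aut U) W ->
  exists2 S, finite_set S & stabilizer S `<=` W.
Proof.
pose F : set_system (aut U) :=
  [set W | exists2 S, finite_set S & stabilizer S `<=` W].
have FF : Filter F.
  split.
  - by exists set0.
  - move=> P Q [S Sfin SP] [T Tfin TQ]; exists (S `|` T).
      by rewrite finite_setU.
    move=> g gST; split; [apply: SP|apply: TQ]; apply: stabilizerS gST.
      exact: subsetUl.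
    exact: subsetUr.
  - by move=> P Q PQ [S Sfin SP]; exists S => //; exact: subset_trans PQ.
suff /(_ W) : F --> (1%g : aut U) by exact.
by apply/aut_cvgP => x; exists [set x] => // g; exact.
Qed.

Lemma continuous_aut (T : topologicalType) (F : T -> aut U) :
  (forall t x, \forall s \near t, F s x = F t x) -> continuous F.
Proof. by move=> Fx t; apply/aut_cvgP; exact: Fx. Qed.

End Stabilizer.

Definition reduct (L M : Type) (phi : L -> M) (V : structure M) : structure L :=
  @Structure L V (fun l => interp (phi l)).

Section Reduct.
Variables (L M : Type) (phi : L -> M) (psi : M -> L).
Hypotheses (phiK : cancel phi psi) (psiK : cancel psi phi).

Lemma reductK : cancel (reduct psi) (reduct phi).
Proof.
case=> A rel; congr Structure; apply/funext => l.
by rewrite /= phiK.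
Qed.

Lemma isomorphism_reduct (A B : structure M) (f : A -> B) :
  @isomorphism L (reduct phi A) (reduct phi B) f <-> isomorphism f.
Proof.
split=> -[bijf fP]; split=> // l x y; last exact: fP.
by rewrite -(psiK l); exact: fP.
Qed.

Lemma embedding_reduct (A : structure L) (B : structure M) (f : A -> B) :
  @embedding L A (reduct phi B) f <-> @embedding M (reduct psi A) B f.
Proof.
split=> -[finj fP]; split=> // l x y.
  by rewrite /= fP /= psiK.
by rewrite -{1}(phiK l); exact: fP.
Qed.

Lemma fraisse_limit_reduct (K : structure M -> Prop) (V : structure M) :
    fraisse_limit K V ->
  fraisse_limit (fun A => K (reduct psi A)) (reduct phi V).
Proof.
move=> [countV homV ageV]; split=> // [S T f Sfin Tfin fP|A].
  have [g gP gE] := homV S T f Sfin Tfin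
    ((@isomorphism_reduct (@substructure M V S) (@substructure M V T) f).1 fP).
  by exists g => //; apply/isomorphism_reduct.
rewrite -ageV; split=> -[Afin [f /embedding_reduct fP]]; split=> //.
  by exists f.
by exists f.
Qed.

Lemma isomorphic_reduct_aut (U : structure L) (V : structure M)
    (f : U -> reduct phi V) :
  isomorphism f -> topological_group_isomorphic (aut U) (aut V).
Proof.
move=> [[f' fK f'K] fP].
have conjP (g : aut U) : isomorphism (fun v : V => f (g (f' v)) : V).
  have [[g' gK g'K] gP] := aut_isomorphism g.
  split; first by exists (f \o g' \o f') => v /=; rewrite fK ?gK ?g'K f'K.
  move=> m x y; have := fP (psi m) (f' x) (f' y).
  by rewrite gP fP /= psiK !f'K; exact: iff_sym.
have conj'P (h : aut V) : isomorphism (fun u : U => f' (h (f u))).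
  have [[h' hK h'K] hP] := aut_isomorphism h.
  split; first by exists (f' \o h' \o f) => u /=; rewrite f'K ?hK ?h'K fK.
  by move=> l x y; rewrite !fP /= !f'K -hP.
exists (fun g => Aut (conjP g)), (fun h => Aut (conj'P h)); split.
- by move=> g; apply: autP => u /=; rewrite !fK.
- by move=> h; apply: autP => v /=; rewrite !f'K.
- by move=> g h; apply: autP => v; rewrite aut_mulE /= fK.
- apply: continuous_aut => g v; apply: filterS (aut_nbhs g (f' v)).
  by move=> h /= ->.
- apply: continuous_aut => h u; apply: filterS (aut_nbhs h (f u)).
  by move=> g /= ->.
Qed.

End Reduct.

(** * Ordered metric spaces and their one-point extensions *)

Lemma distance_value_set_double (R : realType) (D : set R) (t : R) :
    distance_value_set D -> D t ->
  exists u, [/\ D u, t <= u, u <= t *+ 2 &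
                forall s, D s -> s <= u \/ t *+ 2 <= u].
Proof.
move=> [Dpos Dsum] Dt; have [u Du] := Dsum _ _ Dt Dt; have t0 := Dpos _ Dt.
have sup_ge s : D s -> (s%:E <= ereal_sup (EFin @` D))%E.
  by move=> Ds; apply: ereal_sup_ubound; exists s.
rewrite /mine; case: ifP => [_ [uE]|/negbT].
  by exists u; split=> // [||s _]; [| |right]; rewrite uE; lra.
rewrite -leNgt => + uE; move: sup_ge; rewrite -uE => sup_ge.
rewrite lee_fin -mulr2n => ut; exists u.
by split=> // [|s Ds]; [|left]; rewrite -lee_fin sup_ge.
Qed.

Lemma distance_value_set_doubling_ind (R : realType) (D : set R) (P : R -> Prop)
    (t : R) :
    distance_value_set D -> D t -> P t ->
    (forall r s, D r -> D s -> P r -> s <= r *+ 2 -> P s) ->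
  forall s, D s -> P s.
Proof.
move=> hD Dt Pt Pdouble s Ds; have t0 := hD.1 _ Dt.
have [n st] : exists n, s <= t *+ n.
  exists (Num.bound (s / t)); rewrite -mulr_natr mulrC -ler_pdivrMr//.
  by apply/ltW/archi_boundP/divr_ge0; [exact/ltW/hD.1|exact: ltW].
suff [r [Dr Pr _ sr]] : exists r, [/\ D r, P r, t <= r & s <= r \/ t *+ n <= r].
  by apply: (Pdouble r) => //; have := hD.1 _ Dr; case: sr => sr; lra.
elim: n {st} => [|n [r [Dr Pr tr sr]]].
  by exists t; split=> //; right; rewrite mulr0n ltW.
have [u [Du ru ur su]] := distance_value_set_double hD Dr.
exists u; split=> //; [exact: Pdouble ur|exact: le_trans ru|].
have [|r2u] := su _ Ds; first by left.
by case: sr => sr; [left|right; rewrite mulrS]; lra.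
Qed.

Local Notation before := (interp (Lt _)).

(* Where no [Dist s] holds, as on the diagonal, the default value is [0]. *)
Definition dist (R : realType) (D : set R) (A : structure (lang D)) (x y : A) :
    R :=
  xget 0 [set val s | s in [set s : D | interp (Dist s) x y]].

Section OrderedMetricSpace.
Variables (R : realType) (D : set R).
Implicit Types A B : structure (lang D).

Lemma eq_dist A B (x y : A) (x' y' : B) :
    (forall s : D, interp (Dist s) x y <-> interp (Dist s) x' y') ->
  dist x y = dist x' y'.
Proof. by move=> xy; congr (xget 0 (_ @` _)); apply/predeqP. Qed.

Lemma ordered_metric_spaceE A : ordered_metric_space A <->
  [/\ metric (@dist R D A), forall x y : A, x <> y -> D (dist x y),
      forall (s : D) (x y : A), interp (Dist s) x y <-> dist x y = val s &
      strict_linear_order (@interp _ A (Lt D))].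
Proof.
split=> [[[d [dm dD dP]] ltA]|[dm dD dP ltA]]; last first.
  by split=> //; exists (@dist R D A).
suff -> : @dist R D A = d by split.
apply/funext => x; apply/funext => y; rewrite /dist.
case: xgetP => [r _ [s /dP-> //]|none]; have [<-|xy] := pselect (x = y).
  by have [_ d0 _ _] := dm; apply/esym/d0.
case: (none (d x y)); exists (SigSub (mem_set (dD _ _ xy))) => //.
exact/dP.
Qed.

Section Metric.
Variable A : structure (lang D).
Hypothesis omA : ordered_metric_space A.
Implicit Types x y z : A.

Lemma dist_ge0 x y : 0 <= dist x y.
Proof. by have /ordered_metric_spaceE[[]] := omA. Qed.

Lemma dist_eq0 x y : dist x y = 0 <-> x = y.
Proof. by have /ordered_metric_spaceE[[]] := omA. Qed.

Lemma distxx x : dist x x = 0. Proof. exact/dist_eq0. Qed.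

Lemma dist_gt0 x y : x <> y -> 0 < dist x y.
Proof.
by move=> xy; rewrite lt_neqAle dist_ge0 andbT; apply/eqP => /esym/dist_eq0.
Qed.

Lemma distC x y : dist x y = dist y x.
Proof. by have /ordered_metric_spaceE[[]] := omA. Qed.

Lemma dist_triangle y x z : dist x z <= dist x y + dist y z.
Proof. by have /ordered_metric_spaceE[[]] := omA. Qed.

Lemma dist_in x y : x <> y -> D (dist x y).
Proof. by have /ordered_metric_spaceE[_ + _ _] := omA; exact. Qed.

Lemma interp_dist (s : D) x y : interp (Dist s) x y <-> dist x y = val s.
Proof. by have /ordered_metric_spaceE[_ _ + _] := omA; exact. Qed.

Lemma before_order : strict_linear_order (@interp _ A (Lt D)).
Proof. by have /ordered_metric_spaceE[] := omA. Qed.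

Lemma beforexx x : ~ before x x.
Proof. by have [] := before_order. Qed.

Lemma before_trans y x z : before x y -> before y z -> before x z.
Proof. by have [_ + _] := before_order; exact. Qed.

Lemma before_total x y : x <> y -> before x y \/ before y x.
Proof. by have [_ _] := before_order; exact. Qed.

Lemma before_neq x y : before x y -> x <> y.
Proof. by move=> + xy; rewrite xy; exact: beforexx. Qed.

Lemma beforeN x y : x <> y -> before x y <-> ~ before y x.
Proof.
move=> xy; split=> [ltxy ltyx|]; first exact: beforexx (before_trans ltxy ltyx).
by case: (before_total xy).
Qed.

Lemma dist_katetov x y z :
  `|dist x y - dist x z| <= dist y z <= dist x y + dist x z.
Proof.
rewrite ler_norml; have := dist_triangle y x z; have := dist_triangle z x y.
by have := dist_triangle x y z; rewrite [dist z y]distC [dist y x]distC; lra.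
Qed.

Lemma triangle_dist x y z : x <> y -> x <> z -> y <> z ->
  triangle D (dist x y) (dist x z) (dist y z).
Proof.
by move=> xy xz yz; split; [split; exact: dist_in|exact: dist_katetov].
Qed.

End Metric.

Lemma ordered_metric_space_local A :
    (forall x y z : A, ordered_metric_space (substructure [set x; y; z])) ->
  ordered_metric_space A.
Proof.
move=> loc; have lift x y z (Q : A -> A -> A -> Prop) :
    (forall S : set A, ordered_metric_space (substructure S) ->
       forall a b c : S, Q (val a) (val b) (val c)) -> Q x y z.
  move=> QS; pose S := [set x; y; z].
  have [xS yS zS] : [/\ x \in S, y \in S & z \in S].
    by split; apply/mem_set; rewrite /S /=; tauto.
  exact: QS (loc x y z) (SigSub xS) (SigSub yS) (SigSub zS).
apply/ordered_metric_spaceE; split.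
- split=> [x y|x y|x y|x y z].
  + apply: (lift x y y (fun x y _ => 0 <= dist x y)) => S omS a b _.
    exact: (dist_ge0 omS a b).
  + apply: (lift x y y (fun x y _ => dist x y = 0 <-> x = y)) => S omS a b _.
    by rewrite [X in X <-> _](dist_eq0 omS a b); split=> [->|/val_inj].
  + apply: (lift x y y (fun x y _ => dist x y = dist y x)) => S omS a b _.
    exact: (distC omS a b).
  + apply: (lift x y z (fun x y z => dist x z <= dist x y + dist y z)) => S omS.
    by move=> a b c; exact: (dist_triangle omS b a c).
- move=> x y; apply: (lift x y y (fun x y _ => x <> y -> D (dist x y))).
  move=> S omS a b _ ab; apply: (dist_in omS (x := a) (y := b)).
  by move=> /(congr1 val).
- move=> s x y.
  apply: (lift x y y (fun x y _ => interp (Dist s) x y <-> dist x y = val s)).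
  by move=> S omS a b _; exact: (interp_dist omS s a b).
split=> [x|x y z|x y].
- apply: (lift x x x (fun x _ _ => ~ before x x)) => S omS a _ _.
  exact: (beforexx omS (x := a)).
- apply: (lift x y z (fun x y z => before x y -> before y z -> before x z)).
  by move=> S omS a b c; exact: (before_trans omS (x := a) (y := b) (z := c)).
- apply: (lift x y y (fun x y _ => x <> y -> before x y \/ before y x)).
  move=> S omS a b _ ab; apply: (before_total omS (x := a) (y := b)).
  by move=> /(congr1 val).
Qed.

Lemma fraisse_limit_ordered A :
  fraisse_limit (@finite_ordered_metric_space R D) A -> ordered_metric_space A.
Proof.
move=> [_ _ ageA]; apply: ordered_metric_space_local => x y z.
have [_ //] : finite_ordered_metric_space (substructure [set x; y; z]).
apply/ageA; split; first exact: finite_substructure (finite_set3 x y z).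
by exists val; exact: substructure_embedding.
Qed.

Definition katetov A (S : set A) (p : A -> R) : Prop :=
  forall x y, S x -> S y -> `|p x - p y| <= dist x y <= p x + p y.

Definition initial_segment A (S P : set A) : Prop :=
  forall x y, S x -> S y -> before x y -> P y -> P x.

Lemma katetov_setU A (S T : set A) (p : A -> R) : ordered_metric_space A ->
    katetov S p -> katetov T p ->
    (forall x y, S x -> T y -> `|p x - p y| <= dist x y <= p x + p y) ->
  katetov (S `|` T) p.
Proof.
move=> omA Sp Tp STp x y [Sx|Tx] [Sy|Ty]; [exact: Sp|exact: STp| |exact: Tp].
by rewrite distrC (distC omA) [p x + _]addrC; exact: STp.
Qed.

Section OnePointExtension.
Variables (A : structure (lang D)) (S : set A) (p : A -> R) (P : set A).

Definition extension_dist (x y : option S) : R :=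
  match x, y with
  | Some a, Some b => dist (val a) (val b)
  | Some a, None => p (val a)
  | None, Some b => p (val b)
  | None, None => 0
  end.

Definition extension_before (x y : option S) : Prop :=
  match x, y with
  | Some a, Some b => before (val a) (val b)
  | Some a, None => P (val a)
  | None, Some b => ~ P (val b)
  | None, None => False
  end.

Definition one_point_extension : structure (lang D) :=
  @Structure (lang D) (option S) (fun l x y => match l with
    | Dist s => extension_dist x y = val s
    | Lt => extension_before x y
    end).

Hypothesis omA : ordered_metric_space A.

Lemma metric_extension_dist : (forall x, S x -> 0 < p x) -> katetov S p ->
  metric extension_dist.
Proof.
move=> ppos pK.
have p0 (a : S) : 0 < p (val a) by apply: ppos; exact: set_valP.
have pT (a b : S) := pK _ _ (set_valP a) (set_valP b).
split=> [[a|] [b|]|[a|] [b|]|[a|] [b|]|[a|] [b|] [c|]] //=.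
- exact: dist_ge0.
- exact/ltW/p0.
- exact/ltW/p0.
- by rewrite dist_eq0//; split=> [/val_inj->|[->]].
- by split=> // pa; have := p0 a; rewrite pa ltxx.
- by split=> // pb; have := p0 b; rewrite pb ltxx.
- exact: distC.
- exact: dist_triangle.
- by have /andP[] := pT a b; rewrite ler_norml; lra.
- by have /andP[] := pT a c.
- by have := p0 a; lra.
- by have /andP[] := pT b c; rewrite ler_norml; lra.
- by have := p0 b; lra.
- by rewrite add0r.
Qed.

Lemma extension_before_order : initial_segment S P ->
  strict_linear_order extension_before.
Proof.
move=> seg; have segS (a b : S) := seg _ _ (set_valP a) (set_valP b).
split=> [[a|]|[a|] [b|] [c|]|[a|] [b|]] //=.
- exact: beforexx.
- exact: before_trans.
- exact: segS.
- move=> Pa nPc; have [ac|] := pselect (val a = val c).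
    by case: nPc; rewrite -ac.
  case/(before_total omA) => // ca; case: nPc; exact: segS ca Pa.
- by move=> nPb bc Pc; apply: nPb; exact: segS bc Pc.
- move=> ab; apply: (before_total omA) => /val_inj eab.
  by apply: ab; rewrite eab.
- by move=> _; exact: EM.
- by move=> _; exact/or_comm/EM.
Qed.

Lemma one_point_extension_ordered : distance_value_set D ->
    (forall x, S x -> D (p x)) -> katetov S p -> initial_segment S P ->
  ordered_metric_space one_point_extension.
Proof.
move=> [Dpos _] pD pK seg; split; last exact: extension_before_order.
exists extension_dist; split=> // [|[a|] [b|] //= ab].
- by apply: metric_extension_dist pK => x /pD/Dpos.
- by apply: dist_in => // /val_inj eab; apply: ab; rewrite eab.
- by apply: pD; exact: set_valP.
- by apply: pD; exact: set_valP.
Qed.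

End OnePointExtension.

Lemma fraisse_limit_one_point_extension (U : structure (lang D)) (S : set U)
    (p : U -> R) (P : set U) :
    distance_value_set D ->
    fraisse_limit (@finite_ordered_metric_space R D) U -> finite_set S ->
    (forall x, S x -> D (p x)) -> katetov S p -> initial_segment S P ->
  exists z, forall x, S x -> dist z x = p x /\ (before x z <-> P x).
Proof.
move=> hD hU Sfin pD pK seg; have omU := fraisse_limit_ordered hU.
pose B := one_point_extension S p P.
have omB : ordered_metric_space B by exact: one_point_extension_ordered.
have Bfin : finite_set [set: B].
  have SS : [set: B] `<=` None |` Some @` [set: S].
    by case=> [a|] _; [right; exists a|left].
  apply: sub_finite_set SS _; rewrite finite_setU; split=> //.
  exact/finite_image/finite_substructure.
have [|||e [einj eP] eE] := @fraisse_limit_extension _ _ U B (substructure S)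
    Some val hU _ (conj Bfin omB).
- exact: finite_substructure.
- split=> [a b []//|[s|] a b //]; exact: (interp_dist omU).
- exact: substructure_embedding.
exists (e None) => x Sx; pose a : S := SigSub (mem_set Sx).
rewrite -{1 3}(eE a : _ = x); split.
  pose s : D := SigSub (mem_set (pD x Sx)).
  exact/(interp_dist omU s)/eP.
exact: iff_sym (eP (Lt D) (Some a) None).
Qed.

Lemma fraisse_limit_homogeneous (U : structure (lang D)) (S : set U)
    (f : U -> U) :
    fraisse_limit (@finite_ordered_metric_space R D) U -> finite_set S ->
    (forall x y, S x -> S y -> dist (f x) (f y) = dist x y /\
       (before (f x) (f y) <-> before x y)) ->
  exists g : aut U, forall x, S x -> g x = f x.
Proof.
move=> hU Sfin fP; have omU := fraisse_limit_ordered hU; have [_ homU _] := hU.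
have [||g gE] := ultrahomogeneous_embeddings (h := val : substructure S -> U)
    (k := f \o val : substructure S -> U) homU (finite_substructure Sfin).
- exact: substructure_embedding.
- have fS (a b : S) := fP _ _ (set_valP a) (set_valP b).
  split=> [a b /= fab|[s|] a b /=]; last exact: iff_sym (fS a b).2.
    by apply/val_inj/(dist_eq0 omU); rewrite -(fS a b).1 fab distxx.
  by rewrite !(interp_dist omU) (fS a b).1.
by exists g => x Sx; exact: (gE (SigSub (mem_set Sx))).
Qed.

End OrderedMetricSpace.

(** * Open subgroups of the automorphism group of a limit *)

Section LimitAutomorphisms.
Variables (R : realType) (D : set R) (U : structure (lang D)).
Implicit Types (S T : set U) (g h k : aut U) (a b c x y z : U).

Lemma aut_dist g x y : dist (g x) (g y) = dist x y.
Proof. by apply: eq_dist => s; have [_ <-] := aut_isomorphism g. Qed.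

Lemma aut_before g x y : before (g x) (g y) <-> before x y.
Proof. by have [_ <-] := aut_isomorphism g. Qed.

Definition same_type S x y : Prop :=
  forall c, S c -> dist x c = dist y c /\ (before c x <-> before c y).

Lemma aut_same_type S g x : stabilizer S g -> same_type S x (g x).
Proof.
move=> gS c Sc; have gc := gS c Sc.
by split; [rewrite -{2}gc aut_dist|rewrite -{2}gc aut_before].
Qed.

Hypothesis hD : distance_value_set D.
Hypothesis hU : fraisse_limit (@finite_ordered_metric_space R D) U.

Let omU : ordered_metric_space U := fraisse_limit_ordered hU.

Lemma same_type_conjugate S x y : finite_set S -> ~ S x -> ~ S y ->
  same_type S x y -> exists2 g, stabilizer S g & g x = y.
Proof.
move=> Sfin nSx nSy xy; pose f := patch id [set x] (cst y).
have fx : f x = y by rewrite /f patchT// mem_set.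
have fS c : S c -> f c = c.
  by move=> Sc; rewrite /f patchC//; apply/mem_set => cx; rewrite -cx in nSx.
have neq z c : ~ S z -> S c -> z <> c by move=> nSz Sc zc; rewrite zc in nSz.
have [||g gE] := fraisse_limit_homogeneous hU (S := x |` S) (f := f).
- by rewrite finite_setU.
- move=> u v [->|Su] [->|Sv]; rewrite ?fx ?fS//.
  + by rewrite !(distxx omU); split=> //; split=> /(beforexx omU).
  + rewrite (beforeN omU (neq _ _ nSx Sv)) (beforeN omU (neq _ _ nSy Sv)).
    by have [-> ->] := xy v Sv.
  + by rewrite ![dist u _](distC omU); have [-> ->] := xy u Su.
by exists g => [c Sc|]; rewrite gE ?fx ?fS//; [right|left].
Qed.

(* The common distance [t] to [b] and [y] is admissible as soon as it is at
   least half their mutual distance and at most twice their distances to [S]. *)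
Lemma stabilizer_midpoint S b y t : finite_set S -> ~ S b -> ~ S y -> D t ->
    (forall c, S c -> dist b c = dist y c) ->
    (forall c, S c -> t <= dist b c *+ 2) -> dist b y <= t *+ 2 ->
  exists h, [/\ stabilizer S h, dist b (h b) = t, dist y (h b) = t &
                before b (h b)].
Proof.
move=> Sfin nSb nSy Dt byS tS tby; have t0 := hD.1 _ Dt.
have neq c : S c -> c <> b by move=> Sc cb; rewrite cb in Sc.
pose p := patch (cst t) S (dist b).
have pS c : S c -> p c = dist b c by move=> Sc; rewrite /p patchT// mem_set.
have pby x : [set b; y] x -> p x = t.
  by move=> xby; rewrite /p patchC//; apply/mem_set; case: xby => ->.
have [||||z zP] := fraisse_limit_one_point_extension hD hU
    (S := [set b; y] `|` S) (p := p) (P := [set x | ~ before b x]).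
- by rewrite finite_setU; split=> //; exact: finite_set2.
- move=> x [/pby->//|Sx]; rewrite pS//; apply: (dist_in omU).
  exact/nesym/neq.
- apply: (katetov_setU omU) => [x x' xby x'by|c c' Sc Sc'|x c xby Sc].
  + rewrite !pby// subrr normr0 (dist_ge0 omU) /= -mulr2n.
    by case: xby x'by => -> [] ->;
      rewrite ?(distxx omU) ?[dist y b](distC omU); lra.
  + by rewrite !pS//; exact: dist_katetov.
  + have -> : dist x c = dist b c by case: xby => ->; rewrite ?byS.
    by rewrite pby// pS// ler_norml; have := tS c Sc; lra.
- by move=> x x' _ _ xx' nbx' bx; apply: nbx'; exact: (before_trans omU) xx'.
have zS c : S c -> dist z c = dist b c /\ (before c z <-> before c b).
  by move=> Sc; rewrite (beforeN omU (neq c Sc)) -pS//; apply: zP; right.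
have [|zb bz] := zP b; first by left; left.
have [|zy _] := zP y; first by left; right.
have nSz : ~ S z.
  move=> Sz; have [zz _] := zS z Sz.
  by have := dist_gt0 omU (nesym (neq z Sz)); rewrite -zz (distxx omU) ltxx.
have [c /zS[-> ->]//|h hS hb] := @same_type_conjugate S b z Sfin nSb nSz.
exists h; split; rewrite ?hb//.
- by rewrite (distC omU) zb pby//; left.
- by rewrite (distC omU) zy pby//; right.
- exact/bz/(beforexx omU).
Qed.

Lemma dist_lower_bound S b : D !=set0 -> finite_set S -> ~ S b ->
  exists2 t, D t & forall c, S c -> t <= dist b c.
Proof.
move=> [s Ds] Sfin nSb.
have ltR : strict_linear_order (fun x y : R => x < y).
  split=> [x|x y z|x y /eqP xy]; first by rewrite ltxx.
    exact: lt_trans.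
  by apply/orP; rewrite -neq_lt.
have [||t tS tmin] := finite_set_least ltR (S := s |` (dist b @` S)).
- by rewrite finite_setU; split=> //; exact: finite_image.
- by exists s; left.
exists t => [|c Sc]; last by rewrite leNgt; apply/negP/tmin; right; exists c.
by case: tS => [->//|[c Sc <-]]; apply: (dist_in omU) => bc; rewrite bc in nSb.
Qed.

Lemma stabilizer_moves S b : D !=set0 -> finite_set S -> ~ S b ->
  exists2 g, stabilizer S g & g b <> b.
Proof.
move=> D0 Sfin nSb; have [t Dt tS] := dist_lower_bound D0 Sfin nSb.
have t0 := hD.1 _ Dt.
have [//|c Sc||h [hS hb _ _]] := stabilizer_midpoint Sfin nSb nSb Dt.
- by have := tS c Sc; lra.
- by rewrite (distxx omU); lra.
by exists h => // hbb; move: t0; rewrite -hb hbb (distxx omU) ltxx.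
Qed.

Section Amalgamation.
Variables (H : set (aut U)) (S : set U) (b : U).
Hypotheses (subH : subgroup H) (Sfin : finite_set S) (nSb : ~ S b).
Hypothesis HbS : stabilizer (b |` S) `<=` H.

Let subHM g h : H g -> H h -> H (g * h)%g.
Proof. by have [_ + _] := subH; exact. Qed.

Let subHV g : H g -> H (g^-1)%g.
Proof. by have [_ _] := subH; exact. Qed.

Let stabSM g h : stabilizer S g -> stabilizer S h -> stabilizer S (g * h)%g.
Proof. by have [_ + _] := subgroup_stabilizer S; exact. Qed.

Let stabSV g : stabilizer S g -> stabilizer S (g^-1)%g.
Proof. by have [_ _] := subgroup_stabilizer S; exact. Qed.

Definition absorbs t : Prop :=
  forall k, stabilizer S k -> dist b (k b) <= t -> H k.

Lemma absorbed_coset h k : stabilizer S h -> stabilizer S k -> H h ->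
  h b = k b -> H k.
Proof.
move=> hS kS Hh hkb; rewrite -(mulVKg h k); apply: subHM => //; apply: HbS.
apply/stabilizer_setU1; rewrite aut_mulE -hkb autK; split=> //.
exact/stabSM/kS/stabSV.
Qed.

Lemma stabilizer_notin k : stabilizer S k -> ~ S (k b).
Proof. by move=> kS Skb; apply: nSb; rewrite -(autK k b) stabSV. Qed.

Lemma stabilizer_pair_conjugate h k : stabilizer S h -> stabilizer S k ->
    dist b (h b) = dist b (k b) -> before b (h b) -> before b (k b) ->
  exists2 g, stabilizer (b |` S) g & g (h b) = k b.
Proof.
move=> hS kS hkb bh bk.
have notin g : stabilizer S g -> before b (g b) -> ~ (b |` S) (g b).
  by move=> gS bg [/esym/(before_neq omU bg)//|]; exact: stabilizer_notin.
apply: same_type_conjugate; [by rewrite finite_setU|exact: notin..|].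
move=> c [->|Sc]; first by rewrite ![dist _ b](distC omU).
have [<- <-] := aut_same_type b hS Sc.
exact: (aut_same_type b kS Sc).
Qed.

(* [k] agrees at [b] with some [g * h], where [h] in [stabilizer T] moves [b]
   by the same distance and in the same direction as [k], and [g] fixes
   [b |` S] pointwise. *)
Lemma absorbs_small T t : S `<=` T -> finite_set T -> ~ T b ->
  stabilizer T `<=` H -> (forall c, T c -> t <= dist b c *+ 2) -> absorbs t.
Proof.
move=> ST Tfin nTb HT tT k kS kt.
wlog bk : k kS kt / before b (k b).
  move=> W; have [bk|] := pselect (b = k b).
    by apply: HbS; apply/stabilizer_setU1.
  case/(before_total omU); first exact: W.
  move=> kb; rewrite -[k]invgK; apply/subHV/W; first exact: stabSV.
    by rewrite -(aut_dist k) autVK (distC omU).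
  by rewrite -(aut_before k) autVK.
have [//|c Tc||h [hT bh _ ltbh]] :=
    stabilizer_midpoint Tfin nTb nTb (dist_in omU (before_neq omU bk)).
- by apply: le_trans kt _; exact: tT.
- by rewrite (distxx omU) mulrn_wge0// dist_ge0.
have hS := stabilizerS ST hT.
have [g gbS ghk] := stabilizer_pair_conjugate hS kS bh ltbh bk.
have [_ gS] := (stabilizer_setU1 _ _ _).1 gbS.
apply: (absorbed_coset (h := (g * h)%g)) => //; first exact: stabSM.
by apply: subHM; [exact: HbS|exact: HT].
Qed.

(* Decompose [k] as [h * (h^-1 * k)], where [h] maps [b] halfway to [k b]. *)
Lemma absorbs_double t u : D t -> absorbs t -> u <= t *+ 2 -> absorbs u.
Proof.
move=> Dt Ht ut k kS ku; have dbk c (Sc : S c) := (aut_same_type b kS Sc).1.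
have [[c [Sc ct]]|nc] := pselect (exists c, S c /\ dist b c *+ 2 < t).
  apply: Ht => //; have := dist_triangle omU c b (k b).
  by rewrite [dist c _](distC omU) -dbk//; lra.
have [|c Sc||h [hS bh kh _]] :=
    stabilizer_midpoint Sfin nSb (stabilizer_notin kS) Dt.
- exact: dbk.
- by rewrite leNgt; apply/negP => ct; apply: nc; exists c.
- exact: le_trans ut.
rewrite -(mulVKg h k); apply: subHM; first by apply: Ht => //; rewrite bh.
apply: Ht; first exact/stabSM/kS/stabSV.
by rewrite -(aut_dist h) aut_mulE autVK (distC omU) kh.
Qed.

Lemma stabilizer_amalgamation T : S `<=` T -> finite_set T -> ~ T b ->
  stabilizer T `<=` H -> stabilizer S `<=` H.
Proof.
move=> ST Tfin nTb HT g gS.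
have [bg|/(dist_in omU) Dbg] := pselect (b = g b).
  by apply: HbS; apply/stabilizer_setU1.
have [t Dt tT] := dist_lower_bound (ex_intro _ _ Dbg) Tfin nTb.
have absorbs_t : absorbs t.
  apply: (absorbs_small ST) => // c Tc.
  by have := tT c Tc; have := hD.1 _ Dt; lra.
suff absorbsD s : D s -> absorbs s by exact: absorbsD Dbg g gS (lexx _).
move=> Ds; apply: (distance_value_set_doubling_ind hD Dt absorbs_t _ Ds).
by move=> r u Dr _; exact: absorbs_double.
Qed.

End Amalgamation.

Lemma open_subgroup_fixed_point (H : set (aut U)) : subgroup H ->
    nbhs (1%g : aut U) H -> (exists g, ~ H g) ->
  exists b, forall h, H h -> h b = b.
Proof.
move=> subH /nbhs1_stabilizer[S Sfin HS] [g nHg].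
have [_ HM HV] := subH; apply: contrapT => nofix; apply: nHg.
suff : stabilizer set0 `<=` H by exact.
apply: (finite_set_descent (P := fun S => stabilizer S `<=` H) _ Sfin HS).
move=> {Sfin HS}S Sfin S0 HS.
have [b Sb bmin] := finite_set_least (before_order omU) Sfin S0; exists b => //.
have [h Hh bh] : exists2 h, H h & before b (h b).
  have /existsNP[h /not_implyP[Hh]] := proj2 (forallNP _) nofix b.
  case/(before_total omU) => [hb|]; last by exists h.
  by exists (h^-1)%g; [exact: HV|rewrite -(aut_before h) autVK].
apply: (@stabilizer_amalgamation H (S `\ b) b _ _ _ _
  (S `\ b `|` h @` S)) => //.
- exact: finite_setD.
- by case=> _; exact.
- by rewrite setD1K.
- rewrite finite_setU; split; [exact: finite_setD|exact: finite_image].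
- move=> [[_ /(_ erefl)//]|[x Sx hxb]]; apply: (bmin x Sx).
  by rewrite -(aut_before h) hxb.
move=> k kT; have Hconj : H (h^-1 * k * h)%g.
  by apply/HS/stabilizer_image; exact: stabilizerS kT.
have := HM _ _ (HM _ _ Hh Hconj) (HV _ Hh).
by rewrite !mulgA mulgV mul1g mulgK.
Qed.

Lemma point_stabilizer_inj a b : (forall g, g a = a -> g b = b) -> a = b.
Proof.
move=> ab; apply: contrapT => neq.
have [|||g ga] := @stabilizer_moves [set a] b; last by apply; exact/ab/ga.
- by exists (dist a b); exact: (dist_in omU).
- exact: finite_set1.
- exact/nesym.
Qed.

Lemma isometric_pair_conjugate a a' b b' : before a a' -> before b b' ->
    dist a a' = dist b b' ->
  exists g, g a = b /\ g a' = b'.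
Proof.
move=> aa' bb' ab; pose f := patch (cst b') [set a] (cst b).
have fa : f a = b by rewrite /f patchT// mem_set.
have fa' : f a' = b'.
  by rewrite /f patchC//; exact/mem_set/nesym/(before_neq omU).
have [||g gE] := fraisse_limit_homogeneous hU (S := [set a; a']) (f := f).
- exact: finite_set2.
- have ba : ~ before a' a by apply/(beforeN omU (before_neq omU aa')).
  have bb : ~ before b' b by apply/(beforeN omU (before_neq omU bb')).
  move=> u v [->|->] [->|->]; rewrite ?fa ?fa' ?(distxx omU).
  + by split=> //; split=> /(beforexx omU).
  + by rewrite ab; split.
  + by rewrite (distC omU) -ab (distC omU); split.
  + by split=> //; split=> /(beforexx omU).
by exists g; rewrite !gE//; [right|left].
Qed.

Lemma limit_nonempty : [set: U] !=set0.
Proof.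
have [||||z _] := fraisse_limit_one_point_extension hD hU
  (S := set0) (p := fun=> 0) (P := set0) => //.
by exists z.
Qed.

Lemma triangle_realized r s t : triangle D r s t ->
  exists a b c, [/\ dist a b = r, dist a c = s & dist b c = t].
Proof.
move=> [[Dr Ds Dt] rst]; have [a _] := limit_nonempty.
have [r0 s0 t0] : [/\ 0 < r, 0 < s & 0 < t] by split; exact: hD.1.
have katetov1 x (p : U -> R) : 0 <= p x -> katetov [set x] p.
  by move=> px u v -> ->; rewrite subrr normr0 (distxx omU) lexx addr_ge0.
have [|||//|b bP] := fraisse_limit_one_point_extension hD hU
  (S := [set a]) (p := fun=> r) (P := setT).
- exact: finite_set1.
- by [].
- exact/katetov1/ltW.
have [ba _] := bP a erefl.
have neq : b <> a by move=> e; move: r0; rewrite -ba e (distxx omU) ltxx.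
pose p := patch (cst t) [set a] (cst s).
have pa : p a = s by rewrite /p patchT// mem_set.
have pb : p b = t by rewrite /p patchC//; exact/mem_set.
have [|||//|c cP] := fraisse_limit_one_point_extension hD hU
  (S := [set a; b]) (p := p) (P := setT).
- exact: finite_set2.
- by move=> u [->|->]; rewrite ?pa ?pb.
- apply: (katetov_setU omU) => [||u v -> ->]; [apply: katetov1..|].
  + by rewrite pa ltW.
  + by rewrite pb ltW.
  + by rewrite pa pb (distC omU) ba; move: rst; rewrite !ler_norml; lra.
exists a, b, c; split; rewrite (distC omU)//.
  by have [|-> _] := cP a; [left|].
by have [|-> _] := cP b; [right|].
Qed.

End LimitAutomorphisms.

(** * Equivalent distance sets give isomorphic groups *)

Definition triangle_preserving (R : realType) (D E : set R) (f : R -> R) :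
    Prop :=
  forall x y z, triangle D x y z -> triangle E (f x) (f y) (f z).

Lemma equilateral_triangle (R : realType) (D : set R) (x : R) :
  distance_value_set D -> D x -> triangle D x x x.
Proof.
by move=> hD Dx; have := hD.1 _ Dx; split=> //; rewrite subrr normr0; lra.
Qed.

Lemma triangle_preserving_in (R : realType) (D E : set R) (f : R -> R) :
    distance_value_set D -> triangle_preserving D E f ->
  forall x, D x -> E (f x).
Proof. by move=> hD fT x /(equilateral_triangle hD)/fT[[]]. Qed.

Lemma equivalentP (R : realType) (D E : set R) :
    distance_value_set D -> distance_value_set E ->
  equivalent D E <->
  exists f f', [/\ triangle_preserving D E f, triangle_preserving E D f',
    forall x, D x -> f' (f x) = x & forall x, E x -> f (f' x) = x].
Proof.
move=> hD hE; split=> [[f [fE finj fsurj] fT]|[f [f' [fT f'T fK f'K]]]].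
  have /choice[f' f'P] y : exists x, E y -> D x /\ f x = y.
    have [/fsurj[x Dx <-]|nE] := pselect (E y); first by exists x.
    by exists y => /nE.
  exists f, f'; split=> [x y z xyz|x y z xyz|x Dx|x /f'P[]//].
  - by apply/fT => //; case: xyz => -[].
  - have [[Ex Ey Ez] _] := xyz.
    have [Dx xE] := f'P _ Ex; have [Dy yE] := f'P _ Ey.
    have [Dz zE] := f'P _ Ez.
    by apply/fT => //; rewrite xE yE zE.
  - have [Dfx ffx] := f'P _ (fE _ Dx).
    by apply: finj => //; exact: mem_set.
have fE := triangle_preserving_in hD fT.
have f'D := triangle_preserving_in hE f'T.
exists f; first split.
- exact: fE.
- by move=> x y /set_mem Dx /set_mem Dy fxy; rewrite -(fK x)// fxy fK.
- by move=> y Ey; exists (f' y); [exact: f'D|exact: f'K].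
move=> x y z Dx Dy Dz; split; first exact: fT.
by move=> /f'T; rewrite !fK.
Qed.

Definition lang_map (R : realType) (D E : set R) (f : R -> R)
    (fE : forall x, D x -> E (f x)) (l : lang D) : lang E :=
  match l with
  | Dist s => Dist (SigSub (mem_set (fE _ (set_valP s))))
  | Lt => Lt E
  end.

Lemma lang_mapK (R : realType) (D E : set R) (f f' : R -> R)
    (fE : forall x, D x -> E (f x)) (f'D : forall x, E x -> D (f' x)) :
  (forall x, D x -> f' (f x) = x) -> cancel (lang_map fE) (lang_map f'D).
Proof.
move=> fK [s|//]; congr Dist; apply: val_inj => /=; apply: fK.
exact: set_valP.
Qed.

Section RelabelledSpace.
Variables (R : realType) (D E : set R) (f : R -> R) (A : structure (lang D)).
Hypotheses (hD : distance_value_set D) (hE : distance_value_set E).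
Hypotheses (fT : triangle_preserving D E f) (omA : ordered_metric_space A).

Definition relabelled_dist (x y : A) : R :=
  if pselect (x = y) is left _ then 0 else f (dist x y).

Lemma relabelled_distxx x : relabelled_dist x x = 0.
Proof. by rewrite /relabelled_dist; case: pselect. Qed.

Lemma relabelled_distE x y : x <> y -> relabelled_dist x y = f (dist x y).
Proof. by rewrite /relabelled_dist; case: pselect. Qed.

Lemma relabelled_dist_in x y : x <> y -> E (relabelled_dist x y).
Proof.
move=> xy; rewrite relabelled_distE//.
exact/(triangle_preserving_in hD fT)/(dist_in omA).
Qed.

Lemma metric_relabelled_dist : metric relabelled_dist.
Proof.
have dC x y : relabelled_dist x y = relabelled_dist y x.
  have [->//|xy] := pselect (x = y).
  by rewrite !relabelled_distE 1?(distC omA)//; exact: nesym.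
have d_gt0 x y : x <> y -> 0 < relabelled_dist x y.
  by move=> /relabelled_dist_in/hE.1.
have d_ge0 x y : 0 <= relabelled_dist x y.
  by have [->|/d_gt0/ltW//] := pselect (x = y); rewrite relabelled_distxx.
split=> // [x y|x y z].
  split=> [dxy|->]; last exact: relabelled_distxx.
  by apply: contrapT => /d_gt0; rewrite dxy ltxx.
have [<-|xy] := pselect (x = y); first by rewrite relabelled_distxx add0r.
have [<-|yz] := pselect (y = z); first by rewrite relabelled_distxx addr0.
have [<-|xz] := pselect (x = z); first by rewrite relabelled_distxx addr_ge0.
rewrite [relabelled_dist x y]dC !relabelled_distE//; last exact: nesym.
by have [_ /andP[_]] := fT (triangle_dist omA (nesym xy) yz xz).
Qed.

Variables (f' : R -> R) (f'D : forall x, E x -> D (f' x)).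
Hypotheses (fK : forall x, D x -> f' (f x) = x).
Hypotheses (f'K : forall x, E x -> f (f' x) = x).

Lemma ordered_metric_space_relabel :
  ordered_metric_space (reduct (lang_map f'D) A).
Proof.
split; last exact: (before_order omA).
exists relabelled_dist; split=> [||s x y].
- exact: metric_relabelled_dist.
- exact: relabelled_dist_in.
have Es : E (sval s) := set_valP s.
rewrite /= (interp_dist omA) /=; have [<-|xy] := pselect (x = y).
  rewrite relabelled_distxx (distxx omA).
  have s0 := hE.1 _ Es; have f's0 := hD.1 _ (f'D Es).
  by split=> e; [move: f's0|move: s0]; rewrite -e ltxx.
rewrite relabelled_distE//; split=> [->|<-]; first exact: f'K.
by rewrite fK//; exact: (dist_in omA).
Qed.

End RelabelledSpace.

Lemma equivalent_isomorphic (R : realType) (D E : set R)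
    (U : structure (lang D)) (V : structure (lang E)) :
    distance_value_set D -> distance_value_set E ->
    fraisse_limit (@finite_ordered_metric_space R D) U ->
    fraisse_limit (@finite_ordered_metric_space R E) V ->
  equivalent D E -> topological_group_isomorphic (aut U) (aut V).
Proof.
move=> hD hE hU hV /(equivalentP hD hE)[f [f' [fT f'T fK f'K]]].
pose phi := lang_map (triangle_preserving_in hD fT).
pose psi := lang_map (triangle_preserving_in hE f'T).
have phiK : cancel phi psi by exact: lang_mapK.
have psiK : cancel psi phi by exact: lang_mapK.
suff relabelled_class : (fun A => finite_ordered_metric_space (reduct psi A)) =
    @finite_ordered_metric_space R D.
  have := fraisse_limit_reduct phiK psiK hV; rewrite relabelled_class.
  move=> /(fraisse_limit_unique hU)[g].
  exact: (isomorphic_reduct_aut psiK (V := V) (f := g)).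
apply/predeqP => A; split=> -[Afin omA]; split=> //; last first.
  exact: (ordered_metric_space_relabel hD hE fT).
rewrite -(reductK phiK A).
exact: (ordered_metric_space_relabel hE hD f'T omA).
Qed.

(** * Isomorphic groups come from equivalent distance sets *)

Definition topological_isomorphism (G H : topologicalGroupType)
    (phi : G -> H) (psi : H -> G) : Prop :=
  [/\ cancel phi psi, cancel psi phi, {morph phi : x y / (x * y)%g},
      continuous phi & continuous psi].

Lemma topological_isomorphism_sym (G H : topologicalGroupType)
    (phi : G -> H) (psi : H -> G) :
  topological_isomorphism phi psi -> topological_isomorphism psi phi.
Proof.
move=> [phiK psiK phiM phic psic]; split=> // x y.
by apply: (canLR phiK); rewrite phiM !psiK.
Qed.

Lemma morph_group1 (G H : groupType) (phi : G -> H) :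
  {morph phi : x y / (x * y)%g} -> phi 1%g = 1%g.
Proof. by move=> phiM; apply: (mulgI (phi 1%g)); rewrite -phiM !mulg1. Qed.

Lemma morph_groupV (G H : groupType) (phi : G -> H) :
  {morph phi : x y / (x * y)%g} -> {morph phi : x / (x^-1)%g}.
Proof.
move=> phiM x; apply: (mulgI (phi x)).
by rewrite -phiM !mulgV; exact: morph_group1.
Qed.

Lemma subgroup_preimage (G H : groupType) (phi : G -> H) (K : set H) :
  {morph phi : x y / (x * y)%g} -> subgroup K -> subgroup (phi @^-1` K).
Proof.
move=> phiM [K1 KM KV]; split=> [|x y Kx Ky|x Kx] /=.
- by rewrite (morph_group1 phiM).
- by rewrite phiM; exact: KM.
- by rewrite (morph_groupV phiM); exact: KV.
Qed.

Definition stabilizer_correspondence (L M : Type) (U : structure L)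
    (V : structure M) (phi : aut U -> aut V) (beta : U -> V) : Prop :=
  forall a (g : aut U), g a = a <-> phi g (beta a) = beta a.

Section LimitIsomorphism.
Variables (R : realType) (D E : set R).
Variables (U : structure (lang D)) (V : structure (lang E)).
Hypotheses (hD : distance_value_set D) (hE : distance_value_set E).
Hypothesis hU : fraisse_limit (@finite_ordered_metric_space R D) U.
Hypothesis hV : fraisse_limit (@finite_ordered_metric_space R E) V.
Variables (phi : aut U -> aut V) (psi : aut V -> aut U).
Hypothesis iso : topological_isomorphism phi psi.

Let omV : ordered_metric_space V := fraisse_limit_ordered hV.

Lemma topological_isomorphism_nonempty : D !=set0 -> E !=set0.
Proof.
move=> D0; have [phiK _ phiM _ _] := iso; have [a _] := limit_nonempty hD hU.
have [//|//|g _ ga] := stabilizer_moves hD hU (S := set0) (b := a) D0.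
apply: contrapT => E0; suff g1 : g = 1%g by rewrite g1 in ga.
apply: (can_inj phiK); rewrite (morph_group1 phiM); apply: autP => v.
apply: contrapT => /(dist_in omV) Ev.
by apply: E0; exists (dist (phi g v) v).
Qed.

Lemma preimage_stabilizer_fixed_point a : D !=set0 ->
  exists b, forall h : aut V, psi h a = a -> h b = b.
Proof.
move=> D0; have [phiK _ _ _ psic] := iso.
have [_ _ psiM _ _] := topological_isomorphism_sym iso.
have [|||b bP] := open_subgroup_fixed_point hE hV
    (H := psi @^-1` stabilizer [set a]).
- exact: subgroup_preimage psiM (subgroup_stabilizer _).
- apply: (psic 1%g); rewrite (morph_group1 psiM).
  by apply: filterS (aut_nbhs 1%g a) => g ga _ ->.
- have [//|//|g _ ga] := stabilizer_moves hD hU (S := set0) (b := a) D0.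
  by exists (phi g); rewrite /= phiK => /(_ a erefl).
by exists b => h ha; apply: bP => _ ->.
Qed.

End LimitIsomorphism.

Section PointCorrespondence.
Variables (R : realType) (D E : set R).
Variables (U : structure (lang D)) (V : structure (lang E)).
Hypotheses (hD : distance_value_set D) (hE : distance_value_set E).
Hypothesis hU : fraisse_limit (@finite_ordered_metric_space R D) U.
Hypothesis hV : fraisse_limit (@finite_ordered_metric_space R E) V.
Variables (phi : aut U -> aut V) (psi : aut V -> aut U).
Hypothesis iso : topological_isomorphism phi psi.

Let omU : ordered_metric_space U := fraisse_limit_ordered hU.
Let omV : ordered_metric_space V := fraisse_limit_ordered hV.

Lemma exists_stabilizer_correspondence : D !=set0 ->
  exists beta, stabilizer_correspondence phi beta.
Proof.
move=> D0; have iso' := topological_isomorphism_sym iso.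
have [phiK _ _ _ _] := iso.
have E0 := topological_isomorphism_nonempty hD hU hV iso D0.
suff /choice[beta betaP] a : exists b, forall g : aut U,
  g a = a <-> phi g b = b by exists beta.
have [b bP] := preimage_stabilizer_fixed_point hD hE hU hV iso a D0.
have [a' aP] := preimage_stabilizer_fixed_point hE hD hV hU iso' b E0.
have aa' : a = a'.
  by apply: (point_stabilizer_inj hD hU) => g ga; apply/aP/bP; rewrite phiK.
by exists b => g; split=> [ga|/aP]; [apply: bP; rewrite phiK|rewrite -aa'].
Qed.

Variable beta : U -> V.
Hypothesis betaP : stabilizer_correspondence phi beta.

Lemma correspondence_equivariant (g : aut U) a : beta (g a) = phi g (beta a).
Proof.
have [_ psiK phiM _ _] := iso; apply: (point_stabilizer_inj hE hV) => h hga.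
have : (g^-1 * (psi h * g))%g a = a.
  by rewrite !aut_mulE (betaP (g a) (psi h)).2 ?psiK// autK.
rewrite betaP !phiM psiK (morph_groupV phiM) !aut_mulE.
by move=> /(congr1 (phi g)); rewrite autVK.
Qed.

Lemma correspondence_dist : exists f : R -> R,
  forall a a', dist (beta a) (beta a') = f (dist a a').
Proof.
have orbit a a' b b' : before a a' -> before b b' -> dist a a' = dist b b' ->
    dist (beta a) (beta a') = dist (beta b) (beta b').
  move=> aa' bb' ab.
  have [g [<- <-]] := isometric_pair_conjugate hU aa' bb' ab.
  by rewrite !correspondence_equivariant aut_dist.
suff /choice[f fP] s : exists t, forall a a', dist a a' = s ->
  dist (beta a) (beta a') = t by exists f => a a'; exact: fP.
have [[a [a' [aa' <-]]]|nex] :=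
    pselect (exists a a' : U, before a a' /\ dist a a' = s).
  exists (dist (beta a) (beta a')) => b b' bb'.
  have neq : b <> b'.
    by move=> e; have := dist_gt0 omU (before_neq omU aa');
      rewrite -bb' e (distxx omU) ltxx.
  have [ltbb'|ltbb'] := before_total omU neq; first exact: orbit.
  by rewrite (distC omV); apply: orbit; rewrite // (distC omU).
exists 0 => a a' aa's.
have [->|aa'] := pselect (a = a'); first exact: (distxx omV).
case: nex; have [ltaa'|ltaa'] := before_total omU aa'; first by exists a, a'.
by exists a', a; rewrite (distC omU).
Qed.

Variable f : R -> R.
Hypothesis fP : forall a a', dist (beta a) (beta a') = f (dist a a').

Lemma correspondence_triangle_preserving : triangle_preserving D E f.
Proof.
move=> r s t rst; have [[Dr Ds Dt] _] := rst.
have beta_inj : injective beta.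
  by move=> a b ab; apply: (point_stabilizer_inj hD hU) => g; rewrite !betaP ab.
have beta_neq x y z : dist x y = z -> D z -> beta x <> beta y.
  by move=> <- /hD.1 + /beta_inj xy; rewrite xy (distxx omU) ltxx.
have [a [b [c [ab ac bc]]]] := triangle_realized hD hU rst.
rewrite -ab -ac -bc -!fP; apply: (triangle_dist omV).
- exact: beta_neq Dr.
- exact: beta_neq Ds.
- exact: beta_neq Dt.
Qed.

Variable gamma : V -> U.
Hypothesis gammaP : stabilizer_correspondence psi gamma.

Lemma correspondenceK : cancel beta gamma.
Proof.
have [phiK _ _ _ _] := iso.
move=> a; apply/esym/(point_stabilizer_inj hD hU) => g /betaP/gammaP.
by rewrite phiK.
Qed.

Lemma correspondence_dist_cancel (f' : R -> R) :
    (forall b b', dist (gamma b) (gamma b') = f' (dist b b')) ->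
  forall r, D r -> f' (f r) = r.
Proof.
move=> f'P r /(equilateral_triangle hD)/(triangle_realized hD hU).
by move=> [a [b [_ [<- _ _]]]]; rewrite -fP -f'P !correspondenceK.
Qed.

End PointCorrespondence.

Lemma isomorphic_equivalent (R : realType) (D E : set R)
    (U : structure (lang D)) (V : structure (lang E)) :
    distance_value_set D -> distance_value_set E ->
    fraisse_limit (@finite_ordered_metric_space R D) U ->
    fraisse_limit (@finite_ordered_metric_space R E) V ->
  topological_group_isomorphic (aut U) (aut V) -> equivalent D E.
Proof.
move=> hD hE hU hV [phi [psi iso]].
have iso' : topological_isomorphism psi phi := topological_isomorphism_sym iso.
have [D0|D0] := pselect (D !=set0); last first.
  have E0 : ~ (E !=set0).
    by move=> E0; apply/D0/(topological_isomorphism_nonempty hE hV hU iso' E0).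
  apply/equivalentP => //; exists id, id; split=> // x y z.
  - by move=> [[Dx _ _] _]; case: D0; exists x.
  - by move=> [[Ex _ _] _]; case: E0; exists x.
have E0 := topological_isomorphism_nonempty hD hU hV iso D0.
have [beta betaP] := exists_stabilizer_correspondence hD hE hU hV iso D0.
have [gamma gammaP] := exists_stabilizer_correspondence hE hD hV hU iso' E0.
have [f fP] := correspondence_dist hE hU hV iso betaP.
have [f' f'P] := correspondence_dist hD hV hU iso' gammaP.
apply/equivalentP => //; exists f, f'; split.
- exact: (correspondence_triangle_preserving hD hU hV betaP fP).
- exact: (correspondence_triangle_preserving hE hV hU gammaP f'P).
- exact: (correspondence_dist_cancel hD hU iso betaP fP gammaP f'P).
- exact: (correspondence_dist_cancel hE hV iso' gammaP f'P betaP fP).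
Qed.

Theorem theorem5p4 (R : realType) (Delta Lambda : set R)
    (hDelta : distance_value_set Delta) (hLambda : distance_value_set Lambda)
    (cDelta : countable Delta) (cLambda : countable Lambda)
    (U : structure (lang Delta)) (V : structure (lang Lambda))
    (hU : fraisse_limit (@finite_ordered_metric_space R Delta) U)
    (hV : fraisse_limit (@finite_ordered_metric_space R Lambda) V) :
  topological_group_isomorphic (aut U) (aut V) <-> equivalent Delta Lambda.
Proof.
by split; [exact: isomorphic_equivalent|exact: equivalent_isomorphic].
Qed.
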